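(* The S-tree corresponds one-to-one to the reduced rational numbers in the interval $(0,1]$; that is, every vertex of the S-tree is a reduced fraction in $(0,1]$, and every reduced rational number in $(0,1]$ occurs at exactly one vertex of the S-tree.
   Context: The S-tree is the infinite binary tree of fractions defined as follows. Level 0 consists of the single vertex $\frac{1}{1}$, which has exactly one child, $\frac{1}{2}$, in level 1. Every vertex $\frac{m}{n}$ in level $k\ge 1$ has a left child $\frac{m}{m+n}$ and a right child $\frac{n}{m+n}$ in level $k+1$. *)

(* Defs.v *)
From mathcomp Require Import all_boot all_order all_algebra.

Set Implicit Arguments.
Unset Strict Implicit.
Unset Printing Implicit Defensive.

Import Order.TTheory GRing.Theory Num.Theory.

(** A fraction m/n is the pair [(m, n)], not the rational number it denotes:
    the tree is built by an operation on numerators and denominators. *)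
Definition fraction : Type := (nat * nat)%type.

Definition reduced (f : fraction) : bool := (0 < f.2)%N && coprime f.1 f.2.

Definition frac_value (f : fraction) : rat := (f.1%:R / f.2%:R)%R.

(** Vertices are positions in the tree, so that the same fraction could a
    priori label several of them. [Sbelow] is the type of positions in levels
    k >= 1, where every vertex has two children; the vertex of level 0 has the
    single child [SBelow SHalf]. *)
Inductive Sbelow : Type :=
  | SHalf
  | SLeft of Sbelow
  | SRight of Sbelow.

Inductive Svertex : Type :=
  | SRoot
  | SBelow of Sbelow.

Definition left_frac (f : fraction) : fraction := (f.1, f.1 + f.2)%N.
Definition right_frac (f : fraction) : fraction := (f.2, f.1 + f.2)%N.

Fixpoint Sbelow_frac (v : Sbelow) : fraction :=
  match v with
  | SHalf => (1, 2)%N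
  | SLeft u => left_frac (Sbelow_frac u)
  | SRight u => right_frac (Sbelow_frac u)
  end.

Definition Sfrac (v : Svertex) : fraction :=
  match v with
  | SRoot => (1, 1)%N
  | SBelow u => Sbelow_frac u
  end.

(* Main.v *)
Require Import Defs.
From mathcomp Require Import all_boot all_order all_algebra.
From mathcomp Require Import zify.

(** The children m/(m+n) and n/(m+n) of a fraction m/n < 1 lie in (0,1/2) and
    (1/2,1) respectively, so a fraction in (0,1) other than 1/2 determines both
    the side on which it hangs and its parent, and the parent has a smaller
    denominator. Both existence and uniqueness follow by descent to 1/2; this is
    the subtractive Euclidean algorithm. *)

Set Implicit Arguments.
Unset Strict Implicit.
Unset Printing Implicit Defensive.

Import Order.TTheory GRing.Theory Num.Theory.
Local Open Scope ring_scope.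

Lemma Sbelow_frac_lt (v : Sbelow) :
  (0 < (Sbelow_frac v).1 < (Sbelow_frac v).2)%N.
Proof. by elim: v => [|u|u] //=; lia. Qed.

Lemma Sbelow_frac_coprime (v : Sbelow) :
  coprime (Sbelow_frac v).1 (Sbelow_frac v).2.
Proof.
elim: v => [|u IHu|u IHu] //=; rewrite /coprime.
  by rewrite gcdnDl.
by rewrite gcdnDr gcdnC.
Qed.

Lemma Sbelow_frac_inj : injective Sbelow_frac.
Proof.
elim=> [|u IHu|u IHu] [|v|v] //=; rewrite /left_frac /right_frac.
- by case; have := Sbelow_frac_lt v; lia.
- by case; have := Sbelow_frac_lt v; lia.
- by case; have := Sbelow_frac_lt u; lia.
- case=> eq1 eq2; congr SLeft; apply: IHu.
  by apply/eqP; rewrite -pair_eqE /=; lia.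
(* A left child [(a, a + b)] equal to a right child [(d, c + d)] forces a = d and b = c, against a <
   b and c < d. *)
- by case; have := Sbelow_frac_lt u; have := Sbelow_frac_lt v; lia.
- by case; have := Sbelow_frac_lt u; lia.
- by case; have := Sbelow_frac_lt u; have := Sbelow_frac_lt v; lia.
case=> eq2 eq1; congr SRight; apply: IHu.
by apply/eqP; rewrite -pair_eqE /=; lia.
Qed.

Lemma Sbelow_frac_surj (m n : nat) :
  (0 < m < n)%N -> coprime m n -> exists v, Sbelow_frac v = (m, n).
Proof.
elim/ltn_ind: n m => n IHn m /andP[m_gt0 lt_mn].
have [d d_gt0 def_n] : exists2 d, (0 < d)%N & n = (m + d)%N.
  by exists (n - m)%N; lia.
rewrite {}def_n {lt_mn} in IHn *.
(* Comparing [m] with [d] compares m/(m+d) with 1/2; the parent is m/d on a left edge and d/m on a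
   right edge, with denominator below m+d. *)
rewrite /coprime gcdnDl => co_md; case: (ltngtP m d) => [lt_md|lt_dm|eq_md].
- have [|||v def_v] := IHn d _ m; [lia | lia | by [] |].
  by exists (SLeft v); rewrite /= def_v.
- have [|||v def_v] := IHn m _ d; [lia | lia | by rewrite /coprime gcdnC |].
  by exists (SRight v); rewrite /= def_v /right_frac /= addnC.
(* Coprimality of [m] with itself leaves only [m = 1]. *)
by exists SHalf; move: co_md; rewrite -eq_md gcdnn => /eqP->.
Qed.

Lemma Sfrac_bounds (v : Svertex) : (0 < (Sfrac v).1 <= (Sfrac v).2)%N.
Proof. by case: v => [|u] //=; have := Sbelow_frac_lt u; lia. Qed.

Lemma Sfrac_reduced (v : Svertex) : reduced (Sfrac v).
Proof.
rewrite /reduced; apply/andP; split; first by have := Sfrac_bounds v; lia.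
by case: v => //= u; apply: Sbelow_frac_coprime.
Qed.

(** The root is the only vertex whose numerator equals its denominator. *)
Lemma Sfrac_inj : injective Sfrac.
Proof.
case=> [|u] [|v] //= => [eq11|eq11|/Sbelow_frac_inj-> //].
  by have := Sbelow_frac_lt v; rewrite -eq11.
by have := Sbelow_frac_lt u; rewrite eq11.
Qed.

Lemma Sfrac_surj (f : fraction) :
  reduced f -> (0 < f.1 <= f.2)%N -> exists v, Sfrac v = f.
Proof.
case: f => m n /andP[/= n_gt0 co_mn] /andP[m_gt0]; rewrite leq_eqVlt.
case/orP=> [/eqP eq_mn|lt_mn].
  by exists SRoot; move: co_mn; rewrite -eq_mn /coprime gcdnn => /eqP->.
have [|v def_v] := @Sbelow_frac_surj m n _ co_mn; first by rewrite m_gt0.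
by exists (SBelow v).
Qed.

(** After cross-multiplication to mq = pn, Gauss's lemma makes [n] and [q] divide each other, so
    they agree and can be cancelled. *)
Lemma frac_value_inj : {in reduced &, injective frac_value}.
Proof.
move=> [m n] [p q] /andP[/= n_gt0 co_mn] /andP[/= q_gt0 co_pq] /eqP.
rewrite /frac_value /= eqr_div ?pnatr_eq0 -?lt0n // -!natrM eqr_nat => /eqP eq_x.
have eq_nq : n = q.
  apply/eqP; rewrite eqn_dvd -(Gauss_dvdr q (n := m)) 1?coprime_sym // eq_x.
  rewrite dvdn_mull //= -(Gauss_dvdr n (n := p)) 1?coprime_sym // -eq_x.
  exact: dvdn_mull.
by move: eq_x; rewrite eq_nq => /eqP; rewrite eqn_pmul2r // => /eqP->.
Qed.

Lemma frac_value_gt0_le1 (f : fraction) :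
  (0 < f.2)%N -> (0 < frac_value f <= 1) = (0 < f.1 <= f.2)%N.
Proof.
move=> f2_gt0; rewrite /frac_value ler_pdivrMr ?ltr0n // mul1r ler_nat.
by rewrite pmulr_lgt0 ?invr_gt0 ?ltr0n.
Qed.

Lemma frac_value_surj (r : rat) :
  0 <= r -> exists2 f, reduced f & frac_value f = r.
Proof.
(* The absolute values only pass from integers to naturals: both entries are nonnegative, as [r]
   is. *)
move=> r_ge0; exists (`|numq r|, `|denq r|)%N.
  by rewrite /reduced /= absz_gt0 denq_neq0 coprime_num_den.
rewrite /frac_value /= -[RHS]divq_num_den !pmulrn.
by rewrite !gez0_abs ?denq_ge0 ?numq_ge0.
Qed.

Theorem theorem2 :
  (forall v : Svertex,
      reduced (Sfrac v) /\ 0 < frac_value (Sfrac v) <= 1) /\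
  (forall r : rat, 0 < r <= 1 ->
      exists! v : Svertex, frac_value (Sfrac v) = r).
Proof.
split=> [v|r r_01].
  have red_v := Sfrac_reduced v; split=> //.
  by rewrite frac_value_gt0_le1 ?Sfrac_bounds //; case/andP: red_v.
have [|f red_f def_r] := @frac_value_surj r; first by case/andP: r_01 => /ltW.
have [|v def_f] := Sfrac_surj red_f.
  by rewrite -frac_value_gt0_le1 ?def_r //; case/andP: red_f.
exists v; split=> [|w def_w]; first by rewrite def_f.
(* The value determines the reduced fraction, which in turn determines the vertex. *)
apply/Sfrac_inj/frac_value_inj; rewrite ?[_ \in _]Sfrac_reduced //.
by rewrite def_f def_r def_w.
Qed.
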